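(* For all $f,g,h\in\mathbf{L}$, $f\star(g\sqcap h)=(f\star g)\sqcap(f\star h)$.
   Context: Let $I=[0,1]$ and let $\mathbf{M}$ be the set of all maps $I\to I$; $\wedge,\vee$ denote minimum and maximum of real numbers. A function $f\in\mathbf{M}$ is normal if $\sup\{f(x)\mid x\in I\}=1$, and convex if $f(y)\ge f(x)\wedge f(z)$ whenever $0\le x\le y\le z\le 1$. $\mathbf{L}$ is the set of all normal and convex $f\in\mathbf{M}$. For $B\subseteq I$, $\bm{1}_B$ is the characteristic function of $B$. For $f,g\in\mathbf{M}$ define $(f\sqcap g)(x)=\sup\{f(y)\wedge g(z)\mid y\wedge z=x\}$ (meet-convolution; $\mathbf{L}$ is closed under $\sqcap$). For $f\in\mathbf{M}$ let $f^{L}(x)=\sup\{f(y)\mid y\le x\}$ and $f^{R}(x)=\sup\{f(y)\mid y\ge x\}$. The binary operation $\star:\mathbf{L}^2\to\mathbf{M}$ is defined as follows (it is known to take values in $\mathbf{L}$). If $f=\bm{1}_{\{1\}}$, then $f\star g=g\star f=g$. If $f\ne\bm{1}_{\{1\}}$ and $g\ne\bm{1}_{\{1\}}$, then $$(f\star g)(t)=\begin{cases} f^{L}(t)\vee g^{L}(t), & t\in[0,\eta),\\ 1, & t\in[\eta,\xi),\\ f^{R}(\xi)\wedge g^{R}(\xi), & t=\xi,\\ 0, & t\in(\xi,1],\end{cases}$$ where $\eta=\inf\{x\in I\mid f^{L}(x)=1\}\wedge\inf\{x\in I\mid g^{L}(x)=1\}$ and $\xi=\sup\{x\in I\mid f^{R}(x)=1\}\wedge\sup\{x\in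 I\mid g^{R}(x)=1\}$ (one always has $\eta\le\xi$). *)

(* Defs.v *)
From HB Require Import structures.
From mathcomp Require Import all_boot all_order all_algebra.
From mathcomp Require Import interval_inference.
From mathcomp Require Import boolp classical_sets reals.

Set Implicit Arguments.
Unset Strict Implicit.
Unset Printing Implicit Defensive.

Import Order.TTheory GRing.Theory Num.Theory.

Local Open Scope classical_set_scope.
Local Open Scope ring_scope.

Section UnitIntervalMaps.
Variable R : realType.

Local Notation I := {i01 R}.

Fact supI_ge0 (A : set I) : 0 <= sup [set x%:num | x in A].
Proof.
have [->|/set0P[a Aa]] := eqVneq A set0; first by rewrite image_set0 sup0.
apply: (@le_trans _ _ a%:num) => //; apply: ub_le_sup; last by exists a.
by exists 1 => _ [x _ <-].
Qed.

Fact supI_le1 (A : set I) : sup [set x%:num | x in A] <= 1.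
Proof.
have [->|/set0P[a Aa]] := eqVneq A set0; first by rewrite image_set0 sup0.
by apply: ge_sup => [|_ [x _ <-]]; first by exists a%:num, a.
Qed.

Fact infI_ge0 (A : set I) : 0 <= inf [set x%:num | x in A].
Proof.
have [->|/set0P[a Aa]] := eqVneq A set0; first by rewrite image_set0 inf0.
by apply: lb_le_inf => [|_ [x _ <-]]; first by exists a%:num, a.
Qed.

Fact infI_le1 (A : set I) : inf [set x%:num | x in A] <= 1.
Proof.
have [->|/set0P[a Aa]] := eqVneq A set0; first by rewrite image_set0 inf0.
apply: (@le_trans _ _ a%:num) => //.
apply: ge_inf; last by exists a.
by exists 0 => _ [x _ <-].
Qed.

(* Supremum and infimum of a subset of [0, 1], computed in R. Both return 0 on
   the empty set; for supI this is the supremum in [0, 1], while infI is only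
   meaningful on nonempty sets (1 belongs to {x | f^L(x) = 1} for f normal). *)
Definition supI (A : set I) : I := Itv01 (supI_ge0 A) (supI_le1 A).

Definition infI (A : set I) : I := Itv01 (infI_ge0 A) (infI_le1 A).

Definition normal_map (f : I -> I) : Prop := supI (range f) = 1%:i01.

Definition convex_map (f : I -> I) : Prop :=
  forall x y z : I, x <= y -> y <= z -> Order.min (f x) (f z) <= f y.

Definition Lmaps : set (I -> I) :=
  [set f | normal_map f /\ convex_map f].

Definition charI (B : set I) : I -> I :=
  fun x => if `[< B x >] then 1%:i01 else 0%:i01.

Definition meet_conv (f g : I -> I) : I -> I := fun x =>
  supI [set v | exists y z : I, Order.min y z = x /\ v = Order.min (f y) (g z)].

Definition mapL (f : I -> I) : I -> I :=
  fun x => supI [set f y | y in [set y : I | y <= x]].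

Definition mapR (f : I -> I) : I -> I :=
  fun x => supI [set f y | y in [set y : I | x <= y]].

Definition star_eta (f g : I -> I) : I :=
  Order.min (infI [set x : I | mapL f x = 1%:i01])
            (infI [set x : I | mapL g x = 1%:i01]).

Definition star_xi (f g : I -> I) : I :=
  Order.min (supI [set x : I | mapR f x = 1%:i01])
            (supI [set x : I | mapR g x = 1%:i01]).

(* Defined on all maps for totality; meant for f, g in Lmaps, where
   star_eta f g <= star_xi f g, so that the cases below are disjoint. *)
Definition star (f g : I -> I) : I -> I :=
  if `[< f = charI [set 1%:i01] >] then g
  else if `[< g = charI [set 1%:i01] >] then f
  else fun t =>
    let eta := star_eta f g in
    let xi := star_xi f g in
    if t < eta then Order.max (mapL f t) (mapL g t)
    else if t < xi then 1%:i01
    else if t == xi then Order.min (mapR f xi) (mapR g xi)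
    else 0%:i01.

End UnitIntervalMaps.

(* Main.v *)
Require Import Defs.
From mathcomp Require Import all_boot all_order all_algebra.
From mathcomp Require Import interval_inference.
From mathcomp Require Import boolp classical_sets reals.

(** Every operation involved becomes a lattice expression once a map is written
    as a meet of a nondecreasing and a nonincreasing map.

    A convex map is [f = f^L /\ f^R]. If [k1 = A1 /\ B1] and [k2 = A2 /\ B2], where
    [Bi] is the right envelope of [ki], then the meet-convolution of [k1] and
    [k2] is [(A1 \/ A2) /\ (B1 /\ B2)] ([meet_conv_envelopes]).

    For the star operation, truncate the envelopes: with [eta] the infimum of
    [f^L = 1] and [xi] the supremum of [f^R = 1], let [A_f] ([capL]) be [f^L]
    raised to 1 from [eta] on, and let [B_f] ([capR]) be [f^R] lowered to 0
    beyond [xi]. The case distinction in the definition of star then says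
    exactly that, for [f] and [g] different from the characteristic function of
    {1}, the star of [f] and [g] is [(A_f \/ A_g) /\ (B_f /\ B_g)] ([starE]),
    and its right envelope is the second factor ([mapR_star]). Moreover
    meet-convolution sends [A] to joins and [B] to meets ([capL_meet_conv],
    [capR_meet_conv]). Hence both sides of the theorem equal
    [(A_f \/ A_g \/ A_h) /\ (B_f /\ B_g /\ B_h)].

    The characteristic function of {1}, which star treats separately, is neutral
    for meet-convolution as well, and it is a meet-convolution of two normal
    maps only if both are equal to it. The exceptional cases thus reduce to the
    idempotence of meet-convolution and to the fact that [f] absorbs the star of
    [f] and [g] ([meet_conv_star]), which holds because [f^L <= A_f] and
    [B_f <= f^R]. *)

Set Implicit Arguments.
Unset Strict Implicit.
Unset Printing Implicit Defensive.

Import Order.TTheory GRing.Theory Num.Theory.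

Local Open Scope classical_set_scope.
Local Open Scope ring_scope.

Section Envelopes.
Variable R : realType.
Local Notation I := {i01 R}.
(* The widening proofs are spelled out: left implicit in 0%:i01 and 1%:i01, they
   are not inferred inside tactic arguments. *)
Local Notation zero := (@widen_itv R _ 0%:itv _ (unify'P erefl) : I).
Local Notation one := (@widen_itv R _ 1%:itv _ (unify'P erefl) : I).
Local Notation min := Order.min.
Local Notation max := Order.max.
Local Notation eps := (charI [set one]).
Implicit Types (f g h k : I -> I) (x y z t a b c : I) (S T : set I).

(** * Suprema and infima in the unit interval *)

Lemma le_one x : x <= one.
Proof. by rewrite -num_le /=. Qed.

Lemma zero_le x : zero <= x.
Proof. by rewrite -num_le /=. Qed.

Lemma one_le x : one <= x -> x = one.
Proof. by move=> h; apply/le_anti; rewrite le_one. Qed.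

Lemma le_zero x : x <= zero -> x = zero.
Proof. by move=> h; apply/le_anti; rewrite h zero_le. Qed.

Lemma min1x x : min one x = x.
Proof. exact/min_idPr/le_one. Qed.

Lemma max1x x : max one x = one.
Proof. exact/max_idPl/le_one. Qed.

Lemma minx1 x : min x one = x.
Proof. by rewrite minC min1x. Qed.

Lemma maxx1 x : max x one = one.
Proof. by rewrite maxC max1x. Qed.

Lemma min0x x : min zero x = zero.
Proof. exact/min_idPl/zero_le. Qed.

Lemma minx0 x : min x zero = zero.
Proof. by rewrite minC min0x. Qed.

Lemma le_supI S a : S a -> a <= supI S.
Proof.
move=> Sa; rewrite -num_le /=; apply: ub_le_sup; last by exists a.
by exists 1 => _ [x _ <-].
Qed.

Lemma supI_le S b : (forall a, S a -> a <= b) -> supI S <= b.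
Proof.
move=> Sb; rewrite -num_le /=.
have [->|/set0P[a Sa]] := eqVneq S set0; first by rewrite image_set0 sup0.
by apply: ge_sup => [|_ [x /Sb xb <-]]; [exists a%:num, a | rewrite num_le].
Qed.

Lemma infI_le S a : S a -> infI S <= a.
Proof.
move=> Sa; rewrite -num_le /=; apply: ge_inf; last by exists a.
by exists 0 => _ [x _ <-].
Qed.

Lemma le_infI S b : S !=set0 -> (forall a, S a -> b <= a) -> b <= infI S.
Proof.
move=> [a Sa] bS; rewrite -num_le /=.
by apply: lb_le_inf => [|_ [x /bS bx <-]]; [exists a%:num, a | rewrite num_le].
Qed.

Lemma lt_supI S b : b < supI S -> exists2 a, S a & b < a.
Proof.
move=> bS; apply: contrapT => no; move: bS; rewrite ltNge => /negP; apply.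
by apply: supI_le => a Sa; rewrite leNgt; apply/negP => ba; apply: no; exists a.
Qed.

Lemma infIU S T : S !=set0 -> T !=set0 ->
  infI (S `|` T) = min (infI S) (infI T).
Proof.
move=> S0 T0; have [s Ss] := S0; apply/le_anti/andP; split.
  rewrite le_min; apply/andP; split; apply: le_infI => // a Ha;
    apply: infI_le; by [left | right].
apply: le_infI; first by exists s; left.
by move=> a [] Ha; rewrite ge_min; apply/orP; [left | right]; apply: infI_le.
Qed.

(** Given a point of each set above some bound, the smaller of the two is above
    the bound and, by down-closedness, lies in both sets. *)
Lemma supI_setI S T :
    (forall a b, a <= b -> S b -> S a) -> (forall a b, a <= b -> T b -> T a) ->
  supI (S `&` T) = min (supI S) (supI T).
Proof.
move=> dS dT; apply/le_anti/andP; split.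
  by rewrite le_min; apply/andP; split; apply: supI_le => a [Sa Ta];
    apply: le_supI.
rewrite leNgt; apply/negP; rewrite lt_min => /andP[/lt_supI[a Sa aS]].
move=> /lt_supI[b Tb bT].
have : min a b <= supI (S `&` T).
  apply: le_supI; split.
    by apply: dS Sa; rewrite ge_min lexx.
  by apply: dT Tb; rewrite ge_min lexx orbT.
by rewrite leNgt lt_min aS bT.
Qed.

Lemma lt_dense x y : x < y -> exists2 t, x < t & t < y.
Proof.
rewrite -num_lt => xy.
have [xm my] := midf_lt xy.
have m0 : 0 <= (x%:num + y%:num) / 2 by rewrite (le_trans _ (ltW xm)).
have m1 : (x%:num + y%:num) / 2 <= 1 by rewrite (le_trans (ltW my)).
by exists (Itv01 m0 m1); rewrite -num_lt.
Qed.

(** * The monotone envelopes *)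

Lemma le_mapL f y t : y <= t -> f y <= mapL f t.
Proof. by move=> yt; apply: le_supI; exists y. Qed.

Lemma le_mapR f y t : t <= y -> f y <= mapR f t.
Proof. by move=> yt; apply: le_supI; exists y. Qed.

Lemma mapL_le f t c : (forall y, y <= t -> f y <= c) -> mapL f t <= c.
Proof. by move=> fc; apply: supI_le => _ [y yt <-]; apply: fc. Qed.

Lemma mapR_le f t c : (forall y, t <= y -> f y <= c) -> mapR f t <= c.
Proof. by move=> fc; apply: supI_le => _ [y yt <-]; apply: fc. Qed.

Lemma mapR_homo f x y : x <= y -> mapR f y <= mapR f x.
Proof. by move=> xy; apply: mapR_le => z; move/(le_trans xy)/le_mapR. Qed.

Lemma normal_mapL1 f : normal_map f -> mapL f one = one.
Proof.
move=> nf; apply: one_le; rewrite -[X in X <= _]nf; apply: supI_le => _ [y _ <-].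
exact/le_mapL/le_one.
Qed.

(** No value of a normal map escapes both envelopes: each point lies on one side
    of [t]. *)
Lemma normal_maxLR f t : normal_map f -> max (mapL f t) (mapR f t) = one.
Proof.
move=> nf; apply: one_le; rewrite -[X in X <= _]nf; apply: supI_le => _ [y _ <-].
by rewrite le_max; case: (leP y t) => [/le_mapL ->//|/ltW/le_mapR ->];
  rewrite orbT.
Qed.

Lemma convex_minLR f t : convex_map f -> f t = min (mapL f t) (mapR f t).
Proof.
move=> cf; apply/le_anti/andP; split; first by rewrite le_min le_mapL ?le_mapR.
rewrite leNgt; apply/negP; rewrite lt_min => /andP[/lt_supI[_ [y yt <-]] fy].
move=> /lt_supI[_ [z tz <-]] fz.
by have := cf _ _ _ yt tz; rewrite leNgt lt_min fy fz.
Qed.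

(** * Meet-convolution of maps given by their envelopes *)

Lemma le_meet_conv f g y z : min (f y) (g z) <= meet_conv f g (min y z).
Proof. by apply: le_supI; exists y, z. Qed.

Lemma meet_conv_le f g x c :
  (forall y z, min y z = x -> min (f y) (g z) <= c) -> meet_conv f g x <= c.
Proof. by move=> H; apply: supI_le => _ [y [z [yz ->]]]; apply: H. Qed.

Lemma meet_convC f g : meet_conv f g = meet_conv g f.
Proof.
by apply/funext => x; apply/le_anti/andP; split; apply: meet_conv_le => y z <-;
  rewrite minC (minC y) le_meet_conv.
Qed.

(** Fixing the first argument at [x] leaves the second free above [x]. This is
    one half of the pointwise formula for meet-convolution. *)
Lemma meet_conv_mapR f g x : min (f x) (mapR g x) <= meet_conv f g x.
Proof.
rewrite leNgt; apply/negP; rewrite lt_min => /andP[fx /lt_supI[_ [z xz <-]] gz].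
have := le_meet_conv f g x z.
by rewrite (min_idPl xz) leNgt lt_min fx gz.
Qed.

(** If the minimum of [y] and [z] is [x], then one of them is [x] and the other
    lies above it. *)
Lemma meet_conv_maxE f g x :
  meet_conv f g x = max (min (f x) (mapR g x)) (min (mapR f x) (g x)).
Proof.
apply/le_anti/andP; split; last first.
  by rewrite ge_max meet_conv_mapR minC meet_convC meet_conv_mapR.
apply: meet_conv_le => y z; rewrite le_max; case: (leP y z) => yz <-.
  by rewrite le_min2 ?le_mapR.
by rewrite [X in _ || X]le_min2 ?orbT // le_mapR // ltW.
Qed.

(** The pointwise formula is [(A1 /\ B1 /\ B2) \/ (B1 /\ A2 /\ B2)], and
    distributivity factors out [B1 /\ B2]. Monotonicity of the factors enters
    only through the right envelopes. *)
Lemma meet_conv_envelopes f g (Af Bf Ag Bg : I -> I) x :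
    f x = min (Af x) (Bf x) -> mapR f x = Bf x ->
    g x = min (Ag x) (Bg x) -> mapR g x = Bg x ->
  meet_conv f g x = min (max (Af x) (Ag x)) (min (Bf x) (Bg x)).
Proof.
move=> fE fR gE gR.
by rewrite meet_conv_maxE fE gE fR gR -minA (minCA (Bf x)) min_maxl.
Qed.

(** A minimum [y /\ z] is at least [t] exactly when [y] and [z] are, so the two
    suprema separate. *)
Lemma mapR_meet_conv f g t :
  mapR (meet_conv f g) t = min (mapR f t) (mapR g t).
Proof.
apply/le_anti/andP; split.
  apply: mapR_le => x tx; apply: meet_conv_le => y z yz.
  by apply: le_min2; apply: le_mapR; rewrite (le_trans tx) // -yz ge_min lexx
    ?orbT.
rewrite leNgt; apply/negP; rewrite lt_min => /andP[/lt_supI[_ [y ty <-]] fy].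
move=> /lt_supI[_ [z tz <-]] gz.
have : min (f y) (g z) <= mapR (meet_conv f g) t.
  by apply: le_trans (le_meet_conv f g y z) _; apply: le_mapR; rewrite le_min ty.
by rewrite leNgt lt_min fy gz.
Qed.

(** If [f y] exceeded the right-hand side for some [y <= t], then every
    [f y /\ g z] being at most that value would bound all of [g] strictly below
    1, against normality. *)
Lemma mapL_le_meet_conv f g t :
  normal_map g -> mapL f t <= mapL (meet_conv f g) t.
Proof.
move=> ng; apply: mapL_le => y yt; rewrite leNgt; apply/negP => fy.
suff : one <= mapL (meet_conv f g) t.
  by rewrite leNgt (lt_le_trans fy) ?le_one.
rewrite -[X in X <= _]ng; apply: supI_le => _ [z _ <-].
have : min (f y) (g z) <= mapL (meet_conv f g) t.
  by apply: le_trans (le_meet_conv f g y z) _; apply: le_mapL;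
    rewrite ge_min yt.
by rewrite ge_min leNgt fy.
Qed.

Lemma mapL_meet_conv f g t : normal_map f -> normal_map g ->
  mapL (meet_conv f g) t = max (mapL f t) (mapL g t).
Proof.
move=> nf ng; apply/le_anti/andP; split; last first.
  by rewrite ge_max mapL_le_meet_conv // meet_convC mapL_le_meet_conv.
apply: mapL_le => x xt; apply: meet_conv_le => y z yzx.
move: yzx xt; case: (leP y z) => _ <- xt.
  by rewrite ge_min le_max le_mapL.
by rewrite ge_min !le_max (le_mapL g xt) !orbT.
Qed.

(** * The unit *)

Lemma meet_conv_charI1 f : normal_map f -> meet_conv f eps = f.
Proof.
move=> nf; apply/funext => x; apply/le_anti/andP; split.
  apply: meet_conv_le => y z <-; rewrite /charI; case: asboolP => [->|_].
    by rewrite !minx1.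
  by rewrite minx0 zero_le.
have := le_meet_conv f eps x one.
by rewrite /charI asboolT // !minx1.
Qed.

(** The left envelope of a meet-convolution dominates that of [f], so [f] must
    vanish away from 1, and normality then forces [f 1 = 1]. *)
Lemma meet_conv_eq_charI1 f g : normal_map f -> normal_map g ->
  meet_conv f g = eps -> f = eps.
Proof.
move=> nf ng fg.
have f0 y : y != one -> f y = zero.
  move=> y1; apply: le_zero; apply: le_trans (le_mapL f (lexx y)) _.
  apply: le_trans (mapL_le_meet_conv f y ng) _; rewrite fg.
  apply: mapL_le => z zy; rewrite /charI; case: asboolP => // z1.
  by move: y1; rewrite (@one_le y) ?eqxx // -z1.
apply/funext => x; rewrite /charI; case: asboolP => [->|/eqP/f0 //].
apply: one_le; rewrite -[X in X <= _]nf; apply: supI_le => _ [y _ <-].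
by have [->//|/f0 ->] := eqVneq y one; apply: zero_le.
Qed.

(** * The truncated envelopes *)

(** The contribution of one map to the thresholds [star_eta] and [star_xi],
    which are the minima of two such contributions. *)
Definition eta1 f := infI [set x | mapL f x = one].
Definition xi1 f := supI [set x | mapR f x = one].

Definition capL f t := if t < eta1 f then mapL f t else one.

Definition capR f t :=
  if t < xi1 f then one else if t == xi1 f then mapR f t else zero.

Lemma le_capL f t : mapL f t <= capL f t.
Proof. by rewrite /capL; case: ifP => // _; apply: le_one. Qed.

Lemma le_map_capL f t : f t <= capL f t.
Proof. exact/(le_trans _ (le_capL f t))/le_mapL. Qed.

Lemma lt_xi1_mapR f t : t < xi1 f -> mapR f t = one.
Proof.
move=> /lt_supI[a fa ta]; apply: one_le.
by rewrite -[X in X <= _]fa; apply/mapR_homo/ltW.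
Qed.

(** The truncation only acts beyond [xi1 f], since the right envelope is already
    1 before it; this also covers [xi1 f] itself, where the envelope may jump. *)
Lemma capR_mapR f t : t <= xi1 f -> capR f t = mapR f t.
Proof.
rewrite /capR le_eqVlt => /predU1P[->|txi]; first by rewrite ltxx eqxx.
by rewrite txi lt_xi1_mapR.
Qed.

Lemma capR_gt f t : xi1 f < t -> capR f t = zero.
Proof. by move=> xt; rewrite /capR ltNge (ltW xt) /= gt_eqF. Qed.

Lemma capR_le f t : capR f t <= mapR f t.
Proof.
by case: (leP t (xi1 f)) => [/capR_mapR -> //|/capR_gt ->]; apply: zero_le.
Qed.

Lemma capR_homo f x y : x <= y -> capR f y <= capR f x.
Proof.
move=> xy; case: (leP y (xi1 f)) => [yx|/capR_gt ->]; last exact: zero_le.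
by rewrite !capR_mapR ?(le_trans xy) // mapR_homo.
Qed.

(** Strictly between [xi1 f] and [eta1 f] both envelopes would be below 1,
    although by normality one of them is 1 at each point. *)
Lemma eta1_le_xi1 f : normal_map f -> eta1 f <= xi1 f.
Proof.
move=> nf; rewrite leNgt; apply/negP => lt_xe.
have [t xt te] := lt_dense lt_xe.
have := normal_maxLR t nf; case: (leP (mapL f t) (mapR f t)) => _ f1.
  by move: xt; rewrite ltNge le_supI.
by move: te; rewrite ltNge infI_le.
Qed.

(** Joining the [capL], and meeting the [capR], puts the threshold at the
    minimum of the two, as in the definition of star. *)
Lemma max_capL f g t : max (capL f t) (capL g t) =
  if t < min (eta1 f) (eta1 g) then max (mapL f t) (mapL g t) else one.
Proof.
rewrite /capL lt_min; case: ifP; case: ifP => //= _ _; by rewrite ?max1x ?maxx1.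
Qed.

Lemma min_capR f g t : min (capR f t) (capR g t) =
  if t < min (xi1 f) (xi1 g) then one
  else if t == min (xi1 f) (xi1 g) then min (mapR f t) (mapR g t) else zero.
Proof.
case: (ltgtP t (min (xi1 f) (xi1 g))); last first.
- by move=> tE; rewrite !capR_mapR // tE ge_min lexx ?orbT.
- by rewrite gt_min => /orP[]/capR_gt->; rewrite ?min0x ?minx0.
by rewrite lt_min => /andP[tf tg]; rewrite /capR tf tg minxx.
Qed.

(** In a chain a join is 1 when one of its members is, so the set defining the
    threshold of the convolution is the union of the two sets. *)
Lemma eta1_meet_conv f g : normal_map f -> normal_map g ->
  eta1 (meet_conv f g) = min (eta1 f) (eta1 g).
Proof.
move=> nf ng; rewrite /eta1 -infIU; last 2 first.
- by exists one; apply: normal_mapL1.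
- by exists one; apply: normal_mapL1.
congr infI; apply/seteqP; split => x /=; rewrite mapL_meet_conv //.
  by case: (leP (mapL f x) (mapL g x)) => _ ->; [right | left].
by case=> ->; rewrite ?max1x ?maxx1.
Qed.

Lemma xi1_meet_conv f g : xi1 (meet_conv f g) = min (xi1 f) (xi1 g).
Proof.
have down k a b : a <= b -> mapR k b = one -> mapR k a = one.
  by move=> ab kb; apply: one_le; rewrite -[X in X <= _]kb mapR_homo.
rewrite /xi1 -supI_setI; [|exact: down|exact: down].
congr supI; apply/seteqP; split => x /=; rewrite mapR_meet_conv.
  by move=> fg1; split; apply: one_le; rewrite -[X in X <= _]fg1 ge_min lexx
    ?orbT.
by case=> -> ->; rewrite minxx.
Qed.

Lemma capL_meet_conv f g t : normal_map f -> normal_map g ->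
  capL (meet_conv f g) t = max (capL f t) (capL g t).
Proof.
by move=> nf ng; rewrite max_capL /capL eta1_meet_conv // mapL_meet_conv.
Qed.

Lemma capR_meet_conv f g t :
  capR (meet_conv f g) t = min (capR f t) (capR g t).
Proof. by rewrite min_capR /capR xi1_meet_conv mapR_meet_conv. Qed.

(** * The operation in terms of truncated envelopes *)

Lemma star1l g : star eps g = g.
Proof. by rewrite /star asboolT. Qed.

Lemma star1r f : star f eps = f.
Proof. by rewrite /star; case: asboolP => [->//|_]; rewrite asboolT. Qed.

(** As [eta <= xi], at most one of the two factors differs from 1 at each point:
    the join before [eta], the meet from [xi] on. *)
Lemma starE f g t : f <> eps -> g <> eps ->
    eta1 f <= xi1 f -> eta1 g <= xi1 g ->
  star f g t = min (max (capL f t) (capL g t)) (min (capR f t) (capR g t)).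
Proof.
move=> f1 g1 ef eg; rewrite /star !asboolF // max_capL min_capR.
rewrite /star_eta /star_xi -/(eta1 f) -/(eta1 g) -/(xi1 f) -/(xi1 g).
set e := min (eta1 f) _; set x := min (xi1 f) _.
have ex : e <= x by apply: le_min2.
case: ltP => te.
  by rewrite (lt_le_trans te ex) minx1.
by rewrite min1x; case: ltP => // _; case: eqP => // ->.
Qed.

(** The inequality [<=] holds because star is at most the meet of the [capR],
    which are nonincreasing. For [>=] the
    delicate points are those before [xi], where the supremum to the right of
    [t] has to be 1 even though star may nowhere take the value 1. At [xi] star
    equals [capR f xi /\ capR g xi]; if the minimum is reached by [f], say, then
    star bounds [f] from above between [t] and [xi], its value at [xi] bounds
    [f] from above on the rest, and [f^R t = 1]. *)
Lemma mapR_star f g t : f <> eps -> g <> eps ->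
    eta1 f <= xi1 f -> eta1 g <= xi1 g ->
  mapR (star f g) t = min (capR f t) (capR g t).
Proof.
move=> f1 g1 ef eg; apply/le_anti/andP; split.
  apply: mapR_le => y ty; rewrite starE // ge_min; apply/orP; right.
  by apply: le_min2; apply: capR_homo.
set x := min (xi1 f) (xi1 g).
have xf : x <= xi1 f by rewrite ge_min lexx.
have xg : x <= xi1 g by rewrite ge_min lexx orbT.
have starx : star f g x = min (capR f x) (capR g x).
  by rewrite starE // max_capL ltNge le_min2 // min1x.
case: (ltgtP t x) => [tx|xt|->]; last by rewrite -starx le_mapR.
- set c := mapR (star f g) t.
  (* k is whichever of f and g realizes the value of star at xi. *)
  have below k : (forall y, y < x -> k y <= star f g y) ->
      t < xi1 k -> x <= xi1 k -> capR k x <= c -> one <= c.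
    move=> kstar tk xk kc; rewrite -(lt_xi1_mapR tk); apply: mapR_le => y ty.
    case: (ltP y x) => [/kstar/le_trans|xy]; first by apply; apply: le_mapR.
    by apply: le_trans kc; rewrite capR_mapR // le_mapR.
  have starlt y : y < x -> star f g y = max (capL f y) (capL g y).
    by move=> yx; rewrite starE // min_capR yx minx1.
  apply: le_trans (le_one _) _.
  have : star f g x <= c by apply/le_mapR/ltW.
  rewrite starx ge_min => /orP[]; apply: below; rewrite ?(lt_le_trans tx) //.
    by move=> y /starlt ->; rewrite le_max le_map_capL.
  by move=> y /starlt ->; rewrite le_max (le_map_capL g) orbT.
- move: xt; rewrite gt_min => /orP[]/capR_gt->;
    by rewrite ?min0x ?minx0 zero_le.
Qed.

Lemma meet_conv_idem f : convex_map f -> meet_conv f f = f.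
Proof.
by move=> cf; apply/funext => x; rewrite meet_conv_maxE minC maxxx;
  apply/min_idPr/le_mapR.
Qed.

Lemma meet_conv_star f g : Lmaps f -> Lmaps g -> f <> eps -> g <> eps ->
  meet_conv f (star f g) = star f g.
Proof.
move=> [nf cf] [ng _] f1 g1; have [ef eg] := (eta1_le_xi1 nf, eta1_le_xi1 ng).
apply/funext => x.
rewrite (@meet_conv_envelopes f (star f g) (mapL f) (mapR f)
  (fun t => max (capL f t) (capL g t)) (fun t => min (capR f t) (capR g t))).
- rewrite starE // maxA (max_idPr (le_capL f x)).
  by rewrite (minA (mapR f x)) (min_idPr (capR_le f x)).
- exact: convex_minLR.
- by [].
- exact: starE.
- exact: mapR_star.
Qed.

End Envelopes.

Theorem theorem5 (R : realType) (f g h : {i01 R} -> {i01 R})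
    (hf : Lmaps f) (hg : Lmaps g) (hh : Lmaps h) :
  star f (meet_conv g h) = meet_conv (star f g) (star f h).
Proof.
have [nf cf] := hf; have [ng _] := hg; have [nh _] := hh.
have [->|f1] := pselect (f = charI [set 1%:i01]); first by rewrite !star1l.
have [->|g1] := pselect (g = charI [set 1%:i01]).
  rewrite star1r meet_convC meet_conv_charI1 //.
  have [->|h1] := pselect (h = charI [set 1%:i01]).
    by rewrite star1r meet_conv_idem.
  by rewrite meet_conv_star.
have [->|h1] := pselect (h = charI [set 1%:i01]).
  by rewrite star1r meet_conv_charI1 // meet_convC meet_conv_star.
have [ef eg eh] := And3 (eta1_le_xi1 nf) (eta1_le_xi1 ng) (eta1_le_xi1 nh).
have gh1 : meet_conv g h <> charI [set 1%:i01].
  by move=> /(meet_conv_eq_charI1 ng nh).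
have egh : eta1 (meet_conv g h) <= xi1 (meet_conv g h).
  by rewrite eta1_meet_conv // xi1_meet_conv le_min2.
apply/funext => x; rewrite starE // capL_meet_conv // capR_meet_conv.
rewrite (@meet_conv_envelopes _ (star f g) (star f h)
  (fun t => Order.max (capL f t) (capL g t))
  (fun t => Order.min (capR f t) (capR g t))
  (fun t => Order.max (capL f t) (capL h t))
  (fun t => Order.min (capR f t) (capR h t)));
  [|exact: starE|exact: mapR_star|exact: starE|exact: mapR_star].
by rewrite maxACA maxxx minACA minxx.
Qed.
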